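(* Let $a,b,c,d$ be non-zero integers. Let $H_u\subset\mathbb{R}^3$ be the interior of the convex hull of $T_u\cup T_u^i$, where $T_u$ is the axis-aligned unit square in the plane $x=0$ centered at $(0,a,b)$ and $T_u^i$ is the axis-aligned unit square in the plane $x=1$ centered at $(1,c,d)$. Let $H_v=(0,1)\times\left(-\tfrac12,\tfrac12\right)^2\subset\mathbb{R}^3$, that is, the interior of the convex hull of $T_v\cup T_v^i$, where $T_v$ and $T_v^i$ are the axis-aligned unit squares in the planes $x=0$ and $x=1$ centered at $(0,0,0)$ and $(1,0,0)$ respectively. Then $H_u$ and $H_v$ are disjoint if and only if at least one of the following conditions holds: (1) $\min(a,c)\geq 1$; (2) $\max(a,c)\leq -1$; (3) $\min(b,d)\geq 1$; (4) $\max(b,d)\leq -1$; (5) $|ad-bc|\geq |a-c|+|b-d|$.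
   Context: Coordinates on $\mathbb{R}^3$ are $(x,y,z)$. For $x_0\in\{0,1\}$, the axis-aligned unit square in the plane $x=x_0$ centered at $(x_0,r,s)$ is $\{x_0\}\times[r-\tfrac12,r+\tfrac12]\times[s-\tfrac12,s+\tfrac12]$. Interiors are taken in $\mathbb{R}^3$. *)

(* Defs.v *)
From HB Require Import structures.
From mathcomp Require Import all_boot all_order all_algebra.
From mathcomp Require Import all_classical all_reals all_analysis.

Set Implicit Arguments.
Unset Strict Implicit.
Unset Printing Implicit Defensive.
Import Order.TTheory GRing.Theory Num.Theory.
Import numFieldNormedType.Exports.

Local Open Scope classical_set_scope.
Local Open Scope ring_scope.

(* Points of R^3 are row vectors p : 'rV[R]_3, with x = p 0 0, y = p 0 1 and
   z = p 0 2 (the second argument is an index in 'I_3). *)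

Definition convex_hull (R : numDomainType) (V : lmodType R) (A : set V) :
    set V :=
  smallest (@convex_set R V) A.

Definition unit_square (R : realType) (x0 r s : R) : set 'rV[R]_3 :=
  [set p | [/\ p 0 0 = x0,
               p 0 1 \in `[r - 2^-1, r + 2^-1]
             & p 0 2 \in `[s - 2^-1, s + 2^-1] ] ].

Definition Hu (R : realType) (a b c d : int) : set 'rV[R]_3 :=
  (convex_hull (unit_square 0 a%:~R b%:~R `|` unit_square 1 c%:~R d%:~R))°.

Definition Hv (R : realType) : set 'rV[R]_3 :=
  [set p | [/\ p 0 0 \in `]0, 1[,
               p 0 1 \in `](- 2^-1), 2^-1[
             & p 0 2 \in `](- 2^-1), 2^-1[ ] ].

Arguments Hu : clear implicits.
Arguments Hv : clear implicits.

(* Main.v *)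
Require Import Defs.
From mathcomp Require Import all_boot all_order all_algebra.
From mathcomp Require Import all_classical all_reals all_analysis.
From mathcomp Require Import ring lra zify.

Set Implicit Arguments.
Unset Strict Implicit.
Unset Printing Implicit Defensive.
Import Order.TTheory GRing.Theory Num.Theory.
Import numFieldNormedType.Exports.

Local Open Scope classical_set_scope.
Local Open Scope ring_scope.

(** Slicing both bodies by the plane at abscissa [t], with [0 < t < 1], gives
    two open unit squares: one centred at the origin, the other at the point
    [m(t)] of the segment from [(a, b)] to [(c, d)].  Two such squares meet
    exactly when both coordinates of the difference of their centres are less
    than 1 in absolute value ([disjoint_prismsP]).  So the two bodies are
    disjoint iff the segment, its endpoints excluded, avoids the open square
    [(-1, 1) x (-1, 1)].

    The segment lies on [y * (d - b) - z * (c - a) = a * d - b * c], a line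
    unless its endpoints coincide.  For a line, the linear form on the left
    ranges over the open interval of centre 0 and radius [`|a - c| + `|b - d|]
    when [(y, z)] ranges over the square, so the inequality between absolute
    values says that the line misses the square ([segment_misses_square]); if
    the endpoints coincide, the nonzero integers [a] and [c] are equal, which is
    covered by the other conditions.  Each condition on a
    minimum or a maximum makes one coordinate at least 1 in absolute value all
    along the segment ([norm_lerp_ge]).  Conversely, when these conditions on
    minima and maxima fail, [a] and [c] have opposite signs, being nonzero
    integers, and so have [b] and [d].  A point of the line inside the square
    then has to lie between the endpoints, and one exists if the last inequality
    fails as well ([segment_meets_square]).

    To describe the slices, the interior of the hull is caught between an open
    and a closed prism with the same inequalities, strict and weak.  The closed
    one bounds the hull from above because it is convex, the open one bounds the
    interior from below because it is open.  Their difference is harmless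
    because the other body is open: each of its slices is open, so weak
    inequalities on one side still add up to strict ones. *)

(** * Linear interpolation *)

Definition lerp (R : pzRingType) (t x y : R) := x + t * (y - x).

Lemma lerpN (R : pzRingType) (t x y : R) : lerp t (- x) (- y) = - lerp t x y.
Proof. by rewrite /lerp -opprD mulrN -opprD. Qed.

Lemma lerp_ge (R : realDomainType) (t x y m : R) :
  0 < t < 1 -> m <= x -> m <= y -> m <= lerp t x y.
Proof. by rewrite /lerp => /andP[? ?] ? ?; nra. Qed.

Lemma norm_lerp_ge (R : realDomainType) (t x y m : R) :
  0 < t < 1 -> m <= Num.min x y \/ Num.max x y <= - m -> m <= `|lerp t x y|.
Proof.
move=> t01 [|]; rewrite ?le_min ?ge_max => /andP[mx my].
  by apply: le_trans (ler_norm _); exact: lerp_ge.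
by rewrite -normrN -lerpN; apply: le_trans (ler_norm _);
  apply: lerp_ge; rewrite // lerNr.
Qed.

Lemma norm_conv_le (R : realDomainType) (t x y m : R) :
  0 <= t <= 1 -> `|x| <= m -> `|y| <= m -> `|t * x + (1 - t) * y| <= m.
Proof.
by move=> /andP[t0 t1]; rewrite !ler_norml => /andP[? ?] /andP[? ?]; nra.
Qed.

(** * The hull of two parallel unit squares *)

Lemma row3P (T : Type) (p q : 'rV[T]_3) :
  p 0 0 = q 0 0 -> p 0 1 = q 0 1 -> p 0 2 = q 0 2 -> p = q.
Proof.
move=> e0 e1 e2; apply/rowP => -[[|[|[|//]]] lt_j].
- by rewrite (_ : Ordinal lt_j = 0)//; exact/val_inj.
- by rewrite (_ : Ordinal lt_j = 1)//; exact/val_inj.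
- by rewrite (_ : Ordinal lt_j = 2)//; exact/val_inj.
Qed.

Section prism.
Context {R : realType}.
Implicit Types (t x y z r s : R) (p q : 'rV[R]_3).

Definition point x y z : 'rV[R]_3 := \row_j [:: x; y; z]`_j.

Lemma point0 x y z : point x y z 0 0 = x. Proof. by rewrite mxE. Qed.
Lemma point1 x y z : point x y z 0 1 = y. Proof. by rewrite mxE. Qed.
Lemma point2 x y z : point x y z 0 2 = z. Proof. by rewrite mxE. Qed.

Definition pointE := (point0, point1, point2).

(** Offset of an entry from the centre of the slice through [p].  It is an
    affine function of [p], even though the centre moves; hence the prisms below
    are cut out by affine inequalities. *)
Definition shear (i : 'I_3) r r' p := p 0 i - lerp (p 0 0) r r'.

Definition closed_prism r s r' s' : set 'rV[R]_3 :=
  [set p : 'rV[R]_3 | [/\ 0 <= p 0 0 <= 1, `|shear 1 r r' p| <= 2^-1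
                          & `|shear 2 s s' p| <= 2^-1] ].

Definition open_prism r s r' s' : set 'rV[R]_3 :=
  [set p : 'rV[R]_3 | [/\ 0 < p 0 0 < 1, `|shear 1 r r' p| < 2^-1
                          & `|shear 2 s s' p| < 2^-1] ].

Lemma convE (t : {i01 R}) (p q : convex_lmodType 'rV[R]_3) i :
  (conv t p q : 'rV[R]_3) 0 i = t%:num * p 0 i + (1 - t%:num) * q 0 i.
Proof. by rewrite !mxE. Qed.

Lemma shear_conv (t : {i01 R}) (p q : convex_lmodType 'rV[R]_3) i r r' :
  shear i r r' (conv t p q : 'rV[R]_3) =
    t%:num * shear i r r' p + (1 - t%:num) * shear i r r' q.
Proof. by rewrite /shear /lerp !convE; ring. Qed.

Lemma convex_closed_prism r s r' s' : convex_set (closed_prism r s r' s').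
Proof.
move=> p q t; rewrite !inE => -[px py pz] [qx qy qz].
have t01 : 0 <= t%:num <= 1 by rewrite ge0 le1.
split; first by rewrite convE; nra.
- by rewrite shear_conv; exact: norm_conv_le.
- by rewrite shear_conv; exact: norm_conv_le.
Qed.

Lemma hull_sub_closed_prism r s r' s' :
  convex_hull (unit_square 0 r s `|` unit_square 1 r' s')
    `<=` closed_prism r s r' s'.
Proof.
apply: smallest_sub; first exact: convex_closed_prism.
move=> p [|] [/= px]; rewrite !in_itv /= => py pz;
  split; rewrite /shear /lerp px ?ler_norml; lra.
Qed.

(** A point of the prism lies on the segment joining the points of the two bases
    that have the same offset from their centres as it has from that of its own
    slice. *)
Lemma open_prism_sub_hull r s r' s' :
  open_prism r s r' s' `<=`
    convex_hull (unit_square 0 r s `|` unit_square 1 r' s').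
Proof.
move=> p [/andP[px0 px1]]; rewrite !ltr_norml => py pz A [cA sA].
(* The weight of the first endpoint in a convex combination is 1 minus the
   abscissa. *)
have t0 : 0 <= 1 - p 0 0 by lra.
have t1 : 1 - p 0 0 <= 1 by lra.
pose u := shear 1 r r' p; pose v := shear 2 s s' p.
have -> : p = conv (Itv01 t0 t1)
    (point 0 (r + u) (s + v) : convex_lmodType 'rV[R]_3)
    (point 1 (r' + u) (s' + v)).
  apply: row3P; rewrite !mxE /= /u /v /shear /lerp.
  1-3: by rewrite /unstable.onem; ring.
apply/set_mem/cA; rewrite inE; apply: sA; [left|right];
  split; rewrite /= ?in_itv /= !pointE // /u /v; lra.
Qed.

Lemma open_norm_lt (T : topologicalType) (f : T -> R) m :
  continuous f -> open [set p | `|f p| < m].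
Proof.
move=> cf; apply: (@open_comp _ _ _ [set x : R | x < m]); last exact: open_lt.
by move=> p _; apply: cvg_norm; exact: cf.
Qed.

Lemma continuous_entry i : continuous (fun p : 'rV[R]_3 => p 0 i).
Proof. by move=> p; exact: coord_continuous. Qed.

Lemma continuous_shear i r r' : continuous (shear i r r').
Proof.
move=> p; apply: (@continuousB _ _ _ (fun p => p 0 i)
  (fun p => lerp (p 0 0) r r')); first exact: continuous_entry.
apply: (@continuousD _ _ _ (cst r)
  (fun p => p 0 0 * (r' - r))); first exact: cst_continuous.
apply: (@continuousM _ _ (fun p => p 0 0) (cst (r' - r))).
- exact: continuous_entry.
- exact: cst_continuous.
Qed.

Lemma open_open_prism r s r' s' : open (open_prism r s r' s').
Proof.
(* The interval ]0, 1[ is the ball of centre and radius 1/2. *)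
rewrite (_ : open_prism _ _ _ _ =
  [set p : 'rV[R]_3 | `|p 0 0 - 2^-1| < 2^-1]
  `&` [set p | `|shear 1 r r' p| < 2^-1]
  `&` [set p | `|shear 2 s s' p| < 2^-1]).
  apply: openI; [apply: openI|]; apply: open_norm_lt.
  - move=> p; apply: (@continuousB _ _ _ (fun p => p 0 0) (cst 2^-1)).
    exact: continuous_entry.
    exact: cst_continuous.
  - exact: continuous_shear.
  - exact: continuous_shear.
apply/seteqP; split=> p /=; rewrite ltr_norml.
  by case=> px py pz; split=> //; split=> //; lra.
by case=> -[px py] pz; split=> //; lra.
Qed.

Lemma open_prism_sub_interior r s r' s' :
  open_prism r s r' s' `<=`
    (convex_hull (unit_square 0 r s `|` unit_square 1 r' s'))°.
Proof.
by rewrite -open_subsetE; [exact: open_prism_sub_hull|exact: open_open_prism].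
Qed.

End prism.

(** Slice by slice, two open unit squares meet iff the coordinates of their
    centres differ by less than 1. *)
Lemma disjoint_prismsP (R : realType) (a b c d : int) :
  Hu R a b c d `&` Hv R = set0 <->
  forall t : R, 0 < t < 1 ->
    ~ (`|lerp t a%:~R c%:~R| < 1 /\ `|lerp t b%:~R d%:~R| < 1).
Proof.
split=> [Huv0 t t01 [y1 z1]|noT].
- (* The midpoint of the centres of two overlapping squares is in both. *)
  pose y := lerp t a%:~R c%:~R : R; pose z := lerp t b%:~R d%:~R : R.
  suff : (Hu R a b c d `&` Hv R) (point t (y / 2) (z / 2)) by rewrite Huv0.
  move: y1 z1; rewrite -/y -/z !ltr_norml => y1 z1; split.
    apply: open_prism_sub_interior; split; rewrite /shear !pointE //.
    - by rewrite -/y ltr_norml; lra.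
    - by rewrite -/z ltr_norml; lra.
  by split; rewrite !pointE in_itv /=; lra.
- apply/seteqP; split=> // p [/interior_subset/hull_sub_closed_prism[_ py pz]].
  move=> [/[!in_itv]/= px y12 z12]; apply: (noT (p 0 0)) => //.
  move: py pz; rewrite /shear.
  set y := lerp _ _ _; set z := lerp _ _ _; rewrite !ler_norml !ltr_norml.
  by move=> ? ?; lra.
Qed.

(** * A segment and the open square of half-side 1 *)

Lemma norm_cross_lt (R : realDomainType) (y z p q : R) :
  `|y| < 1 -> `|z| < 1 -> (p != 0) || (q != 0) ->
  `|y * q - z * p| < `|p| + `|q|.
Proof.
move=> y1 z1 pq; apply: (le_lt_trans (ler_normB _ _)).
rewrite !normrM addrC.
have [p0|p0] := eqVneq p 0.
  have q0 : 0 < `|q| by move: pq; rewrite p0 eqxx normr_gt0.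
  by rewrite p0 normr0 mulr0 !add0r gtr_pMl.
have : `|z| * `|p| < `|p| by rewrite gtr_pMl ?normr_gt0.
have : `|y| * `|q| <= `|q| by rewrite ler_piMl ?normr_ge0 ?(ltW y1).
by move=> h1 h2; rewrite ltr_leD.
Qed.

(** The cross product [y * (d - b) - z * (c - a)] is constant along the segment,
    with value [a * d - b * c], which is too large for a point of the square. *)
Lemma segment_misses_square (R : realDomainType) (t a b c d : R) :
  (c - a != 0) || (d - b != 0) ->
  `|a - c| + `|b - d| <= `|a * d - b * c| ->
  ~ (`|lerp t a c| < 1 /\ `|lerp t b d| < 1).
Proof.
move=> ne_ends far [y1 z1]; have := norm_cross_lt y1 z1 ne_ends.
rewrite (_ : _ - _ = a * d - b * c); last by rewrite /lerp; ring.
by rewrite ltNge (distrC c) (distrC d) far.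
Qed.

(** By symmetry let [a] and [b] be positive.  Then [lerp t a c] is in
    ]-1, 1[ for [t] in the interval of centre [a / (a - c)] and radius
    [(a - c)^-1], and [lerp t b d] for [t] in the interval of centre
    [b / (b - d)] and radius [(b - d)^-1].  The witness divides the segment
    between the centres in proportion to the radii, which puts it in both
    intervals as soon as they overlap. *)
Lemma segment_meets_square (R : realFieldType) (a b c d : R) :
  a * c < 0 -> b * d < 0 -> `|a * d - b * c| < `|a - c| + `|b - d| ->
  exists2 t, 0 < t < 1 & `|lerp t a c| < 1 /\ `|lerp t b d| < 1.
Proof.
move=> ac bd.
wlog a0 : a c ac / 0 < a.
  move=> H; have [a0||a0] := ltgtP a 0; [|exact: H|]; last first.
    by move: ac; rewrite a0 mul0r ltxx.
  move=> abcd; have [||//|t t01] := H (- a) (- c); rewrite ?mulrNN ?oppr_gt0//.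
    have -> : - a * d - b * - c = - (a * d - b * c) by ring.
    by rewrite -opprD !normrN.
  by rewrite lerpN normrN; exists t.
wlog b0 : b d bd / 0 < b.
  move=> H; have [b0||b0] := ltgtP b 0; [|exact: H|]; last first.
    by move: bd; rewrite b0 mul0r ltxx.
  move=> abcd; have [||//|t t01] := H (- b) (- d); rewrite ?mulrNN ?oppr_gt0//.
    have -> : a * - d - - b * c = - (a * d - b * c) by ring.
    by rewrite -opprD !normrN.
  by rewrite lerpN normrN; exists t.
have c0 : c < 0 by rewrite -(pmulr_rlt0 _ a0).
have d0 : d < 0 by rewrite -(pmulr_rlt0 _ b0).
have S0 : 0 < (a - c) + (b - d) by lra.
have Sn0 : (a - c) + (b - d) != 0 by rewrite gt_eqF.
rewrite (gtr0_norm (_ : 0 < a - c)); last lra.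
rewrite (gtr0_norm (_ : 0 < b - d)); last lra.
move=> abcd.
pose t := (a + b) / ((a - c) + (b - d)); exists t.
  apply/andP; split; first by rewrite divr_gt0// addr_gt0.
  by rewrite ltr_pdivrMr// mul1r; lra.
have -> : lerp t a c = - ((a * d - b * c) / ((a - c) + (b - d))).
  by rewrite /lerp /t; field.
have -> : lerp t b d = (a * d - b * c) / ((a - c) + (b - d)).
  by rewrite /lerp /t; field.
rewrite normrN normrM normfV (gtr0_norm S0) ltr_pdivrMr// mul1r.
by split.
Qed.

Theorem theorem4p1 (R : realType) (a b c d : int)
    (ha : a <> 0) (hb : b <> 0) (hc : c <> 0) (hd : d <> 0) :
  Hu R a b c d `&` Hv R = set0 <->
  1 <= Num.min a c \/
  Num.max a c <= -1 \/
  1 <= Num.min b d \/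
  Num.max b d <= -1 \/
  `|a - c| + `|b - d| <= `|a * d - b * c|.
Proof.
rewrite disjoint_prismsP; split=> [noT|].
- apply: contrapT => no5.
  (* Nonzero integers that are neither both positive nor both negative have
     opposite signs. *)
  have [ac bd abcd] : [/\ a * c < 0, b * d < 0
      & `|a * d - b * c| < `|a - c| + `|b - d|].
    by split; nia.
  have [| | |t] := @segment_meets_square R a%:~R b%:~R c%:~R d%:~R.
  + by rewrite -intrM ltrz0.
  + by rewrite -intrM ltrz0.
  + by rewrite -!intrM -!intrB -!intr_norm -intrD ltr_int.
  exact: noT.
- have far t (x y : int) : 0 < t < 1 -> 1 <= Num.min x y \/ Num.max x y <= -1 ->
      (1 : R) <= `|lerp t x%:~R y%:~R|.
    move=> t01 xy; apply: norm_lerp_ge => //; move: xy.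
    by rewrite !le_min !ge_max !ler1z -[- 1 in X in _ -> X](intrN R 1) !ler_int.
  move=> sep t t01 yz; have [y1 z1] := yz.
  have nac : ~ (1 <= Num.min a c \/ Num.max a c <= -1).
    by move=> /(far t _ _ t01); rewrite leNgt y1.
  have nbd : ~ (1 <= Num.min b d \/ Num.max b d <= -1).
    by move=> /(far t _ _ t01); rewrite leNgt z1.
  have {sep} sep : `|a - c| + `|b - d| <= `|a * d - b * c| by tauto.
  apply: segment_misses_square yz.
    (* Equal nonzero integers have the same sign, which [nac] excludes. *)
    by rewrite -!intrB !intr_eq0; apply/orP; left; lia.
  by rewrite -!intrM -!intrB -!intr_norm -intrD ler_int.
Qed.
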